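(* The FCC configuration and the HCP configuration of $12$ points on $\mathbb S^2$ (corresponding to radius $r=1$, i.e. minimal angular distance $\pi/3$) both carry balanced contact graph structures, i.e. both configurations are balanced. Consequently, $r=1$ is a critical value of the radius function on $\mathrm{BConf}(12)$.
   Context: $\mathrm{Conf}(12)\subset(\mathbb S^2)^{12}$ is the space of $12$-tuples $\mathbf U=(\mathbf u_1,\dots,\mathbf u_{12})$ of distinct labeled points on the unit sphere $\mathbb S^2\subset\mathbb R^3$, and $\mathrm{BConf}(12)=\mathrm{Conf}(12)/SO(3)$. For $\mathbf u,\mathbf v\in\mathbb S^2$, $\theta(\mathbf u,\mathbf v)$ is the angular distance. The injectivity radius function is $\rho(\mathbf U)=\frac12\min_{i\neq j}\theta(\mathbf u_i,\mathbf u_j)$; it is $SO(3)$-invariant. The radius function $r$ is the strictly increasing reparametrization of $\rho$ given by $\sin\rho=\frac{r}{1+r}$: $r(\mathbf U)$ is the largest radius such that equal spheres of that radius touching the central unit sphere at the points $\mathbf u_i$ have disjoint interiors. Thus $r=1$ corresponds to $\rho=\pi/6$. FCC configuration: the $12$ vertices of a cuboctahedron inscribed in $\mathbb S^2$; up to rotation, six points on the equator $z=0$ at longitudes $k\pi/3$, three points at height $z=\sqrt{2/3}$ at longitudes $\pi/6+2\pi k/3$, and three points at height $z=-\sqrt{2/3}$ at longitudes $\pi/2+2\pi k/3$. HCP configuration: the $12$ vertices of a triangular orthobicupola inscribed in $\mathbb S^2$; up to rotation, the same equatorial points and the same three points at height $\sqrt{2/3}$, together with the reflections of these three points in the plane $z=0$.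 Contact graph of $\mathbf U$: with $\theta=2\rho(\mathbf U)$, the graph embedded in $\mathbb S^2$ whose vertices are the points $\mathbf u_i$ and whose edges are the geodesic segments $[\mathbf u_i,\mathbf u_j]$ with $\theta(\mathbf u_i,\mathbf u_j)=\theta$. A stress graph is the contact graph with weights $w_e\ge0$ on its edges; edge $e$ exerts at each of its endpoints $\mathbf u$ the force $w_eT_e|_{\mathbf u}$, where $T_e|_{\mathbf u}\in T_{\mathbf u}\mathbb S^2$ is the outward unit tangent vector to $e$ at $\mathbf u$. It is balanced if at each $\mathbf u_i$ these forces sum to zero. $\mathbf U$ is balanced if its contact graph has a balanced stress graph with nonnegative, not everywhere zero weights. Criticality: for $\mathbf V=(\mathbf v_1,\dots,\mathbf v_{12})$ with $\mathbf v_i\in T_{\mathbf u_i}\mathbb S^2$ and small $t$, let $\mathbf U\#t\mathbf V$ be the configuration with entries $\frac{\mathbf u_i+t\mathbf v_i}{|\mathbf u_i+t\mathbf v_i|}$. $\mathbf U$ is critical for maximizing $\rho$ (equivalently $r$) if for every such $\mathbf V$, $\max\{\rho(\mathbf U\#t\mathbf V)-\rho(\mathbf U),0\}=o(t)$ as $t\to0$. A critical value of $r$ is the value of $r$ at a critical configuration. *)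

(* Defs.v *)
From HB Require Import structures.
From mathcomp Require Import all_boot all_order all_algebra all_fingroup.
From mathcomp Require Import all_classical all_reals all_analysis.
From mathcomp Require Import ring.
Set Implicit Arguments.
Unset Strict Implicit.
Unset Printing Implicit Defensive.
Import Order.TTheory GRing.Theory Num.Theory.
Import numFieldNormedType.Exports.
Local Open Scope classical_set_scope.
Local Open Scope ring_scope.

(* The canonical norm of MathComp-Analysis on row vectors is the sup norm, *)
(* hence a separate Euclidean norm.                                        *)
Definition dot (R : realType) (u v : 'rV[R]_3) : R := (u *m v^T) 0 0.

Definition enorm (R : realType) (u : 'rV[R]_3) : R := Num.sqrt (dot u u).

Definition sphere (R : realType) : set 'rV[R]_3 := [set u | enorm u = 1].

Definition angle (R : realType) (u v : 'rV[R]_3) : R := acos (dot u v).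

Definition config (R : realType) (n : nat) := 'I_n -> 'rV[R]_3.

Definition Conf (R : realType) (n : nat) : set (config R n) :=
  [set U | (forall i, sphere (U i)) /\ injective U].

(* Rotations act on row vectors from the right. *)
Definition SO3 (R : realType) : set 'M[R]_3 :=
  [set Q | Q *m Q^T = 1%:M /\ \det Q = 1].

Definition rotate (R : realType) (n : nat) (Q : 'M[R]_3) (U : config R n) :
    config R n :=
  fun i => U i *m Q.

Definition orbit_SO3 (R : realType) (n : nat) (U : config R n) :
    set (config R n) :=
  [set rotate Q U | Q in @SO3 R].

Definition BConf (R : realType) (n : nat) : set (set (config R n)) :=
  [set orbit_SO3 U | U in @Conf R n].

(* The default value pi of the minimum is harmless for n >= 2, since no      *)
(* angular distance exceeds pi.                                              *)
Definition min_angle (R : realType) (n : nat) (U : config R n) : R :=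
  \big[Num.min/pi]_(p : 'I_n * 'I_n | p.1 != p.2) angle (U p.1) (U p.2).

Definition inj_radius (R : realType) (n : nat) (U : config R n) : R :=
  min_angle U / 2.

(* The solution r of sin rho = r / (1 + r), see sphere_radiusP. *)
Definition sphere_radius (R : realType) (n : nat) (U : config R n) : R :=
  sin (inj_radius U) / (1 - sin (inj_radius U)).

Lemma sphere_radiusP (R : realType) (n : nat) (U : config R n) :
  sin (inj_radius U) != 1 ->
  sin (inj_radius U) = sphere_radius U / (1 + sphere_radius U).
Proof.
rewrite /sphere_radius; set s := sin _ => s1.
have d0 : 1 - s != 0 by rewrite subr_eq0 eq_sym.
have -> : 1 + s / (1 - s) = (1 - s)^-1 by field.
by rewrite invrK divfK.
Qed.

Definition contact (R : realType) (n : nat) (U : config R n) : rel 'I_n :=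
  fun i j => (i != j) && (angle (U i) (U j) == 2 * inj_radius U).

Definition contact_edges (R : realType) (n : nat) (U : config R n) :
    set {set 'I_n} :=
  [set e | exists i j, contact U i j /\ e = [set i; j]%SET].

(* Outward unit tangent vector at u of the geodesic segment [u, v]: it is    *)
(* tangent to the great circle through u and v and points away from v.       *)
Definition outward_tangent (R : realType) (u v : 'rV[R]_3) : 'rV[R]_3 :=
  let d := dot u v *: u - v in (enorm d)^-1 *: d.

(* Weights are functions of the unordered edge {i, j}; only their values on  *)
(* contact edges are used.                                                   *)
Definition stress_graph (R : realType) (n : nat) (U : config R n)
    (w : {set 'I_n} -> R) : Prop :=
  forall e, contact_edges U e -> 0 <= w e.

Definition balanced_stress (R : realType) (n : nat) (U : config R n)
    (w : {set 'I_n} -> R) : Prop :=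
  forall i, \sum_(j | contact U i j)
    w [set i; j]%SET *: outward_tangent (U i) (U j) = 0.

Definition is_balanced (R : realType) (n : nat) (U : config R n) : Prop :=
  exists w : {set 'I_n} -> R,
    [/\ stress_graph U w, balanced_stress U w
      & exists2 e, contact_edges U e & w e != 0].

Definition tangent_field (R : realType) (n : nat) (U : config R n) :
    set (config R n) :=
  [set V | forall i, dot (U i) (V i) = 0].

(* U # tV *)
Definition perturb (R : realType) (n : nat) (U V : config R n) (t : R) :
    config R n :=
  fun i => (enorm (U i + t *: V i))^-1 *: (U i + t *: V i).

Definition critical (R : realType) (n : nat) (U : config R n) : Prop :=
  forall V, tangent_field U V ->
    (fun t : R => Num.max (inj_radius (perturb U V t) - inj_radius U) 0)
      =o_ (0 : R) (fun t : R => t).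

(* Criticality and the radius are invariant under SO(3), so at a point of    *)
(* BConf, i.e. an orbit, they are required of all representatives.           *)
Definition critical_value (R : realType) (n : nat) (x : R) : Prop :=
  exists2 O, @BConf R n O &
    forall U, O U -> critical U /\ sphere_radius U = x.

(* The point of the unit sphere of given longitude and height. *)
Definition sphere_pt (R : realType) (longitude height : R) : 'rV[R]_3 :=
  \row_(k < 3) nth 0
    [:: Num.sqrt (1 - height ^+ 2) * cos longitude;
        Num.sqrt (1 - height ^+ 2) * sin longitude;
        height] k.

Definition FCC0 (R : realType) : config R 12 := fun i =>
  if (i < 6)%N then sphere_pt (i%:R * pi / 3) 0
  else if (i < 9)%N then
    sphere_pt (pi / 6 + 2 * pi * (i - 6)%N%:R / 3) (Num.sqrt (2 / 3))
  else sphere_pt (pi / 2 + 2 * pi * (i - 9)%N%:R / 3) (- Num.sqrt (2 / 3)).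

Definition HCP0 (R : realType) : config R 12 := fun i =>
  if (i < 6)%N then sphere_pt (i%:R * pi / 3) 0
  else if (i < 9)%N then
    sphere_pt (pi / 6 + 2 * pi * (i - 6)%N%:R / 3) (Num.sqrt (2 / 3))
  else sphere_pt (pi / 6 + 2 * pi * (i - 9)%N%:R / 3) (- Num.sqrt (2 / 3)).

Definition same_up_to_rotation_and_labels (R : realType) (n : nat)
    (U W : config R n) : Prop :=
  exists2 Q, @SO3 R Q & exists s : {perm 'I_n}, forall i, W i = U (s i) *m Q.

Definition is_FCC (R : realType) (U : config R 12) : Prop :=
  same_up_to_rotation_and_labels (@FCC0 R) U.

Definition is_HCP (R : realType) (U : config R 12) : Prop :=
  same_up_to_rotation_and_labels (@HCP0 R) U.

(* Main.v *)
Require Import Defs.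
From HB Require Import structures.
From mathcomp Require Import all_boot all_order all_algebra all_fingroup.
From mathcomp Require Import all_classical all_reals all_analysis.
From mathcomp Require Import ring lra.
Import Order.TTheory GRing.Theory Num.Theory.
Import numFieldNormedType.Exports.
Local Open Scope classical_set_scope.
Local Open Scope ring_scope.

(** Both configurations have minimal angle pi / 3, and all their inner products
    are rational.  Indeed the twelve points lie in a lattice: each one is
    (a / 2, b sqrt 3 / 6, c sqrt (2 / 3)) for integers a, b, c, so that twelve
    times an inner product is the integral form 3 a a' + b b' + 8 c c'
    ([hex_dot]).  Two points are in contact when this form equals 6, and the
    outward tangent vector at u of a contact edge [u, v] is then a fixed
    multiple of u - 2 v.  Balance of a stress thus becomes a family of integral
    linear equations, which is decided by computation ([hex_certificate]).  For
    FCC all weights can be equal.  For HCP they cannot: over an equatorial edge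
    whose two adjacent faces are the triangles with an upper and a lower apex,
    the pull of the two apices along the equator is not compensated, and this
    edge must be lighter than its equatorial neighbours; the weights 1 on those
    three edges and 3 on all others are in equilibrium.

    A balanced configuration is critical ([balanced_critical]): pairing the
    equilibrium equations with a tangent field V and summing over all vertices
    shows that the weighted sum of the first order variations of the inner
    products over the contact edges vanishes
    ([balanced_nonexpanding]).  Hence for every t some contact edge does not
    open to first order, so the minimal angle grows by at most a quantity
    quadratic in t.  The critical value 1 is then attained on the orbit of the
    FCC configuration. *)

(** * The Euclidean inner product and angles *)

Section Dot.
Context {R : realType}.
Implicit Types (a : R) (u v w : 'rV[R]_3) (Q : 'M[R]_3).

Lemma dotE u v : dot u v = \sum_k u 0 k * v 0 k.
Proof. by rewrite /dot mxE; apply: eq_bigr => k _; rewrite mxE. Qed.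

Lemma dotC u v : dot u v = dot v u.
Proof. by rewrite !dotE; apply: eq_bigr => k _; rewrite mulrC. Qed.

Lemma dotDl u v w : dot (u + v) w = dot u w + dot v w.
Proof. by rewrite /dot mulmxDl mxE. Qed.

Lemma dotZl a u v : dot (a *: u) v = a * dot u v.
Proof. by rewrite /dot -scalemxAl mxE. Qed.

Lemma dotBl u v w : dot (u - v) w = dot u w - dot v w.
Proof. by rewrite -scaleN1r dotDl dotZl mulN1r. Qed.

Lemma dotDr u v w : dot w (u + v) = dot w u + dot w v.
Proof. by rewrite dotC dotDl !(dotC w). Qed.

Lemma dotZr a u v : dot v (a *: u) = a * dot v u.
Proof. by rewrite dotC dotZl (dotC v). Qed.

Lemma dotBr u v w : dot w (u - v) = dot w u - dot w v.
Proof. by rewrite dotC dotBl !(dotC w). Qed.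

Lemma dot_suml (I : finType) (P : pred I) (F : I -> 'rV[R]_3) v :
  dot (\sum_(i | P i) F i) v = \sum_(i | P i) dot (F i) v.
Proof.
elim/big_rec2: _ => [|i x u _ <-]; last by rewrite dotDl.
by rewrite -(scale0r v) dotZl mul0r.
Qed.

Lemma dot_mulmx Q u v : Q *m Q^T = 1%:M -> dot (u *m Q) (v *m Q) = dot u v.
Proof. by move=> QQ; rewrite /dot trmx_mul mulmxA -(mulmxA u) QQ mulmx1. Qed.

Lemma dot_ge0 u : 0 <= dot u u.
Proof. by rewrite dotE sumr_ge0// => k _; rewrite -expr2 sqr_ge0. Qed.

Lemma sqr_enorm u : enorm u ^+ 2 = dot u u.
Proof. by rewrite sqr_sqrtr ?dot_ge0. Qed.

Lemma sphere_dot u : sphere u <-> dot u u = 1.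
Proof.
rewrite /sphere /=; split=> [u1|u1]; first by rewrite -sqr_enorm u1 expr1n.
by rewrite /enorm u1 sqrtr1.
Qed.

Lemma dot_sphere_itv u v : sphere u -> sphere v -> -1 <= dot u v <= 1.
Proof.
move=> /sphere_dot u1 /sphere_dot v1.
have := dot_ge0 (u + v); have := dot_ge0 (u - v).
rewrite !(dotBl, dotBr, dotDl, dotDr) u1 v1 (dotC v u).
by move=> ? ?; apply/andP; split; lra.
Qed.

Lemma cos_angle u v : sphere u -> sphere v -> cos (angle u v) = dot u v.
Proof. by move=> su sv; rewrite acosK// in_itv/= dot_sphere_itv. Qed.

Lemma angle_itv u v : sphere u -> sphere v -> 0 <= angle u v <= pi.
Proof.
by move=> su sv; rewrite /angle acos_ge0 ?acos_lepi// dot_sphere_itv.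
Qed.

Lemma angle_le u v a : sphere u -> sphere v -> 0 <= a <= pi ->
  (angle u v <= a) = (cos a <= dot u v).
Proof.
move=> su sv ai.
by rewrite !leNgt -(cos_angle u v)// ltr_cos// in_itv/= ?angle_itv.
Qed.

(** The normalization of the tangent vector depends only on the inner product,
    so it is the same on all contact edges and factors out of the equilibrium
    equations. *)
Lemma enorm_outward_tangent u v : sphere u -> sphere v ->
  enorm (dot u v *: u - v) = Num.sqrt (1 - dot u v ^+ 2).
Proof.
move=> /sphere_dot u1 /sphere_dot v1; congr Num.sqrt.
by rewrite dotBl !dotBr !dotZl !dotZr u1 v1 (dotC v u); ring.
Qed.

End Dot.

(** * Balanced configurations are critical *)

Section Critical.
Context {R : realType} {n : nat}.
Implicit Types (U V : config R n).

Lemma min_angle_le U i j : i != j -> min_angle U <= angle (U i) (U j).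
Proof.
by move=> ij; rewrite /min_angle (bigmin_le_cond _ (j := (i, j))).
Qed.

Lemma contact_sym U : symmetric (contact U).
Proof. by move=> i j; rewrite /contact eq_sym /angle dotC. Qed.

Lemma double_inj_radius U : 2 * inj_radius U = min_angle U.
Proof. by rewrite /inj_radius mulrC divfK ?pnatr_eq0. Qed.

Lemma contact_dot U i j : (forall i, sphere (U i)) -> contact U i j ->
  dot (U i) (U j) = cos (min_angle U).
Proof.
move=> sU /andP[_ /eqP]; rewrite double_inj_radius => <-.
by rewrite cos_angle.
Qed.

(** The virtual work of an equilibrium stress is zero: the weighted sum over the
    contact edges of the first variations of the inner products vanishes.  With
    nonnegative, not all zero weights these variations cannot all have the sign
    that separates the points.  The bounds on the minimal angle exclude
    coincident and antipodal points, whose tangent vectors degenerate. *)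
Lemma balanced_nonexpanding U V (t : R) :
  (forall i, sphere (U i)) -> 0 < min_angle U < pi ->
  is_balanced U -> tangent_field U V ->
  exists i j, contact U i j /\ 0 <= t * (dot (U i) (V j) + dot (U j) (V i)).
Proof.
move=> sU m0pi [w [w0 wbal [e [i0 [j0 [c0 ->]]] we0]]] tV.
apply: contrapT => noij.
pose c := Num.sqrt (1 - cos (min_angle U) ^+ 2).
have c_gt0 : 0 < c.
  rewrite sqrtr_gt0 -sin2cos2 exprn_gt0// sin_gt0_pi//.
pose W i j := w [set i; j]%SET.
have WC i j : W i j = W j i by rewrite /W finset.setUC.
(* The component of the equilibrium at i along V i; the term along U i drops
   out because V i is tangent. *)
have bal i : \sum_(j | contact U i j) W i j * dot (U j) (V i) = 0.
  have d0 : dot 0 (V i) = 0 by rewrite -(scale0r (V i)) dotZl mul0r.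
  rewrite -[RHS](mulr0 (- c)) -[in RHS]d0 -(wbal i) dot_suml.
  rewrite mulr_sumr; apply: eq_bigr => j cij.
  rewrite /outward_tangent enorm_outward_tangent// contact_dot// -/c.
  rewrite !dotZl dotBl dotZl tV mulr0 sub0r -/(W i j).
  by field; rewrite gt_eqF.
pose l i j := t * (dot (U i) (V j) + dot (U j) (V i)).
(* Each unordered edge is counted in both orders: the two halves of the first
   variation are exchanged by swapping the summation indices. *)
have tot : \sum_(p | contact U p.1 p.2) - (W p.1 p.2 * l p.1 p.2) = 0.
  rewrite -(pair_big_dep xpredT (contact U) (fun i j => - (W i j * l i j)))/=.
  rewrite (eq_bigr (fun i => - \sum_(j | contact U i j)
      t * (W i j * dot (U i) (V j)))); last first.
    move=> i _.
    have ti : \sum_(j | contact U i j) t * (W i j * dot (U j) (V i)) = 0.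
      by rewrite -mulr_sumr bal mulr0.
    rewrite -[RHS]subr0 -[X in _ - X]ti -sumrN -sumrB.
    by apply: eq_bigr => j _; rewrite /l; ring.
  rewrite sumrN (exchange_big_dep xpredT)//= big1 ?oppr0// => j _.
  under eq_bigl => i do rewrite contact_sym.
  under eq_bigr => i _ do rewrite WC.
  by rewrite -mulr_sumr bal mulr0.
have neg p : contact U p.1 p.2 -> 0 <= - (W p.1 p.2 * l p.1 p.2).
  move=> cp; rewrite -mulrN mulr_ge0 ?w0//; first by exists p.1, p.2.
  rewrite oppr_ge0 leNgt; apply/negP => lp; apply: noij.
  by exists p.1, p.2; split => //; exact: ltW.
have := psumr_eq0P neg tot (i := (i0, j0)) c0.
move=> /eqP; rewrite oppr_eq0 mulf_eq0 (negPf we0)/= => /eqP l0.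
by apply: noij; exists i0, j0; split=> //; rewrite -/(l i0 j0) l0.
Qed.

Lemma sphere_perturb U V t : (forall i, sphere (U i)) -> tangent_field U V ->
  forall i, sphere (perturb U V t i).
Proof.
move=> sU tV i; apply/sphere_dot; rewrite /perturb dotZl dotZr -sqr_enorm.
have : 1 <= enorm (U i + t *: V i) ^+ 2.
  have /sphere_dot u1 := sU i.
  rewrite sqr_enorm !(dotDl, dotDr, dotZl, dotZr) u1 (dotC (V i)) tV.
  have := mulr_ge0 (sqr_ge0 t) (dot_ge0 (V i)); lra.
by move=> N1; field; apply: contraTneq N1 => ->; rewrite expr0n/= ler10.
Qed.

(** Normalization and the products of two components of V only contribute to
    second order in t, so on the edge that does not open the inner product
    decreases at most quadratically, with a constant independent of the edge. *)
Lemma balanced_perturb_dot U V : (forall i, sphere (U i)) ->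
  0 < min_angle U < pi -> is_balanced U -> tangent_field U V ->
  exists2 K, 0 <= K & forall t, exists i j, i != j /\
    cos (min_angle U) - K * t ^+ 2
      <= dot (perturb U V t i) (perturb U V t j).
Proof.
move=> sU m0pi bU tV; pose v i := dot (V i) (V i).
have v0 i : 0 <= v i by exact: dot_ge0.
(* One sum of the v i bounds the cross term of V, the other one the product of
   the two norms minus 1. *)
exists (2 * \sum_i v i) => [|t]; first by rewrite mulr_ge0 ?sumr_ge0.
have [i [j [cij tl]]] := balanced_nonexpanding U V t sU m0pi bU tV.
exists i, j; split; first by case/andP: cij.
have vK k : v k <= \sum_i v i by rewrite (bigD1 k)//= lerDl sumr_ge0.
have vm : - (v i + v j) / 2 <= dot (V i) (V j).
  by have := dot_ge0 (V i + V j); rewrite !(dotDl, dotDr) (dotC (V j)) /v; lra.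
move: (vK i) (vK j); set K := \sum_i v i => vi vj.
have N2 k : enorm (U k + t *: V k) ^+ 2 = 1 + t ^+ 2 * v k.
  have /sphere_dot u1 := sU k.
  rewrite sqr_enorm !(dotDl, dotDr, dotZl, dotZr) u1 (dotC (V k)) tV /v; ring.
have N1 k : 1 <= enorm (U k + t *: V k).
  rewrite -(@ler_pXn2r _ 2) ?nnegrE ?sqrtr_ge0 ?ler01// expr1n N2 lerDl.
  by rewrite mulr_ge0 ?sqr_ge0.
rewrite /perturb dotZl dotZr.
have := N1 i; have := N1 j; have := N2 i; have := N2 j.
set a := enorm (U i + _); set b := enorm (U j + _) => b2 a2 b1 a1.
rewrite mulrA -invfM [leRHS]mulrC ler_pdivlMr; last first.
  by rewrite mulr_gt0 ?(lt_le_trans ltr01).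
rewrite !(dotDl, dotDr, dotZl, dotZr) contact_dot//.
rewrite (dotC (V i) (U j)) in tl *.
set d := cos _; set m := dot (V i) (V j) in vm *.
have P1 : 1 <= a * b by rewrite -[1]mulr1 ler_pM.
have PK : a * b <= 1 + t ^+ 2 * K.
  have := sqr_ge0 (a - b); have := ler_wpM2l (sqr_ge0 t) vi.
  have := ler_wpM2l (sqr_ge0 t) vj; nra.
have d1 : d <= 1 by exact: cos_le1.
have Kt : 0 <= t ^+ 2 * K by rewrite mulr_ge0 ?sqr_ge0// (le_trans (v0 i)).
have mK : - K <= m by lra.
have := ler_wpM2l (sqr_ge0 t) mK; set q := t ^+ 2 in Kt PK *.
have : (a * b - 1) * d <= a * b - 1 by rewrite ler_piMr// subr_ge0.
have : q * K <= a * b * (q * K) by rewrite ler_peMl.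
move=> PqK Pd qm.
have -> : (d - 2 * K * q) * (a * b) =
    (a * b - 1) * d + d - 2 * (a * b * (q * K)) by ring.
set y := dot (U j) (V i) in tl *; set x := dot (U i) (V j) in tl *.
have -> : d + t * x + (t * y + t * (t * m)) = d + t * (x + y) + q * m.
  by rewrite /q; ring.
by rewrite mulrN in qm; lra.
Qed.

(** Since the slope of cos at x is - sin x < 0, a linear increase of the angle
    costs a linear decrease of the cosine, which outweighs a quadratic error. *)
Lemma cos_drop (x : R) : 0 < x < pi -> exists2 e, 0 < e &
  forall s, 0 <= s < e -> cos (x + s) <= cos x - sin x / 2 * s.
Proof.
move=> x0pi; have sx : 0 < sin x by exact: sin_gt0_pi.
have : h^-1 *: (cos (h *: 1 + x) - cos x) @[h --> 0^'] --> - sin x.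
  by have [dc <-] := is_derive_cos x; exact: dc.
move=> /(@cvgr_lt _ _ _ _ _ _)/(_ (- (sin x / 2))).
rewrite ltrN2 ltr_pdivrMr// ltr_pMr// ltr1n => /(_ isT).
move=> [e /= e0 he]; exists e => // s /andP[].
rewrite le_eqVlt => /predU1P[<-|s0 se]; first by rewrite addr0 mulr0 subr0.
have := he s; rewrite /= sub0r normrN gtr0_norm// => /(_ se).
rewrite gt_eqF// => /(_ isT); rewrite scaler1 /GRing.scale/= (addrC s).
by rewrite mulrC ltr_pdivrMr// => /ltW; rewrite mulNr => H; lra.
Qed.

Lemma balanced_radius_near U V : (forall i, sphere (U i)) ->
  0 < min_angle U < pi -> is_balanced U -> tangent_field U V ->
  forall eps, 0 < eps -> \forall t \near (0 : R),
    inj_radius (perturb U V t) - inj_radius U <= eps * `|t|.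
Proof.
move=> sU m0pi bU tV eps eps0.
have [K K0 HK] := balanced_perturb_dot U V sU m0pi bU tV.
have [e e0 He] := cos_drop _ m0pi; move: (m0pi) => /andP[m0 mpi].
have sin0 : 0 < sin (min_angle U) by exact: sin_gt0_pi.
have eps2 : 0 < eps * 2 by rewrite mulr_gt0.
near=> t; have [i [j [ij dij]]] := HK t.
rewrite /inj_radius -mulrBl ler_pdivrMr// lerBlDl.
apply: le_trans (min_angle_le _ _ _ ij) _.
(* An angle that opens by s loses a multiple of |t| in its cosine, whereas the
   inner product of the edge loses at most K t^2. *)
pose s := eps * `|t| * 2; have s0 : 0 <= s by rewrite !mulr_ge0 // ltW.
have se : s < e.
  rewrite /s mulrAC mulrC -ltr_pdivlMr//.
  by near: t; apply: (@nbhs0_lt R R^o); rewrite divr_gt0.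
have spi : s <= pi - min_angle U.
  rewrite /s mulrAC mulrC -ler_pdivlMr//.
  by near: t; apply: (@nbhs0_le R R^o); rewrite divr_gt0// subr_gt0.
rewrite angle_le; [|exact: sphere_perturb|exact: sphere_perturb|]; last first.
  by rewrite addr_ge0 ?(ltW m0)//= addrC -lerBrDr.
apply: le_trans (He s _) _; first by rewrite s0.
apply: le_trans dij; rewrite lerD2l lerN2.
have tK : `|t| <= sin (min_angle U) * eps / (K + 1).
  by near: t; apply: (@nbhs0_le R R^o); rewrite divr_gt0 ?mulr_gt0 ?ltr_wpDl.
move: tK; rewrite ler_pdivlMr ?ltr_wpDl// -real_normK ?num_real// /s.
by have := normr_ge0 t; move: `|t| => r r0 tK; nra.
Unshelve. all: by end_near. Qed.

Lemma balanced_critical U : Conf U -> 0 < min_angle U < pi ->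
  is_balanced U -> critical U.
Proof.
move=> [sU _] m0pi bU V tV; apply/eqoP => eps eps0.
apply: filterS (balanced_radius_near U V sU m0pi bU tV eps eps0) => t.
move=> rt; rewrite ger0_norm; last by rewrite le_max lexx orbT.
by rewrite ge_max rt mulr_ge0 ?(ltW eps0).
Qed.

End Critical.

(** * Special angles *)

Section Trig.
Context {R : realType}.

(** With c = cos (pi / 3), the triple angle formula 4 c^3 - 3 c = cos pi reads
    (c + 1) (2 c - 1)^2 = 0. *)
Lemma cos_pi3 : cos (pi / 3) = 1 / 2 :> R.
Proof.
have pi0 := pi_gt0 R.
have c0 : 0 < cos (pi / 3 : R).
  by rewrite cos_gt0_pihalf//; apply/andP; split; lra.
have : cos (pi / 3 + (pi / 3 + pi / 3)) = -1 :> R.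
  by rewrite (_ : _ + _ = pi) ?cospi//; field.
have := cos2Dsin2 (pi / 3 : R); rewrite !(cosD, sinD).
move: (cos _) (sin _) c0 => c s c0 cs h.
have s2 : s ^+ 2 = 1 - c ^+ 2 by rewrite -cs; ring.
have : (c + 1) * (2 * c - 1) ^+ 2 = 0.
  by rewrite -[RHS](subrr (-1)) -[X in _ = X - _]h; ring: s2.
by move/eqP; rewrite mulf_eq0 sqrf_eq0 gt_eqF ?addr_gt0//= => /eqP; lra.
Qed.

Lemma sin_pi3 : sin (pi / 3) = Num.sqrt 3 / 2 :> R.
Proof.
have pi0 := pi_gt0 R.
have s0 : 0 < sin (pi / 3 : R).
  by rewrite sin_gt0_pi//; apply/andP; split; lra.
apply/eqP; rewrite -(@eqrXn2 _ 2) ?(ltW s0) ?divr_ge0 ?sqrtr_ge0//.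
by rewrite sin2cos2 cos_pi3 !expr_div_n sqr_sqrtr//; apply/eqP; field.
Qed.

Lemma pi6E : pi / 6 = pi / 2 - pi / 3 :> R. Proof. by field. Qed.

Lemma cos_pi6 : cos (pi / 6) = Num.sqrt 3 / 2 :> R.
Proof.
by rewrite pi6E cosB cos_pihalf sin_pihalf sin_pi3; ring.
Qed.

Lemma sin_pi6 : sin (pi / 6) = 1 / 2 :> R.
Proof.
by rewrite pi6E sinB cos_pihalf sin_pihalf cos_pi3; ring.
Qed.

End Trig.

(** * Hexagonal lattice coordinates *)

Definition tricoord := (int * int * int)%type.

(** Twelve times the Euclidean inner product, in the coordinates of [hex_pt]. *)
Definition hex_dot (x y : tricoord) : int :=
  3 * x.1.1 * y.1.1 + x.1.2 * y.1.2 + 8 * x.2 * y.2.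

Definition hex_equator : seq tricoord :=
  [:: (2, 0, 0); (1, 3, 0); (-1, 3, 0); (-2, 0, 0); (-1, -3, 0); (1, -3, 0)].

Definition hex_cap (z : int) : seq tricoord :=
  [:: (1, 1, z); (-1, 1, z); (0, -2, z)].

(** The same triangle turned by pi / 3. *)
Definition hex_cap_turned (z : int) : seq tricoord :=
  [:: (0, 2, z); (-1, -1, z); (1, -1, z)].

Definition fcc_coord := hex_equator ++ hex_cap 1 ++ hex_cap_turned (-1).

Definition hcp_coord := hex_equator ++ hex_cap 1 ++ hex_cap (-1).

Section HexPt.
Context {R : realType}.

Definition hex_pt (x : tricoord) : 'rV[R]_3 :=
  \row_(k < 3) nth 0 [:: x.1.1%:~R / 2; x.1.2%:~R * Num.sqrt 3 / 6;
                         x.2%:~R * Num.sqrt (2 / 3)] k.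

Lemma hex_pt_is_zmod_morphism : zmod_morphism hex_pt.
Proof.
move=> x y; apply/rowP => k; rewrite !mxE.
by case: k => [[|[|[|//]]]] /= _; rewrite rmorphB/=; ring.
Qed.

HB.instance Definition _ :=
  GRing.isZmodMorphism.Build tricoord 'rV[R]_3 hex_pt hex_pt_is_zmod_morphism.

Lemma dot_hex_pt x y : dot (hex_pt x) (hex_pt y) = (hex_dot x y)%:~R / 12.
Proof.
rewrite dotE !big_ord_recl big_ord0 !mxE/= addr0 /hex_dot.
rewrite !rmorphD !rmorphM/= !rmorph_nat.
have s3 : Num.sqrt 3 ^+ 2 = 3 :> R by rewrite sqr_sqrtr.
have s23 : Num.sqrt (2 / 3) ^+ 2 = 2 / 3 :> R by rewrite sqr_sqrtr// divr_ge0.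
transitivity (x.1.1%:~R * y.1.1%:~R / 4
  + x.1.2%:~R * y.1.2%:~R * (Num.sqrt 3 ^+ 2) / 36
  + x.2%:~R * y.2%:~R * Num.sqrt (2 / 3) ^+ 2 : R); first by field.
by rewrite s3 s23; field.
Qed.

Lemma sqrt_sphere_height :
  Num.sqrt (1 - Num.sqrt (2 / 3) ^+ 2) = Num.sqrt 3 / 3 :> R.
Proof.
apply/eqP; rewrite -(@eqrXn2 _ 2) ?divr_ge0 ?sqrtr_ge0//.
rewrite expr_div_n !sqr_sqrtr ?divr_ge0//; first by apply/eqP; field.
by rewrite subr_ge0 ler_pdivrMr; lra.
Qed.

Lemma cosDpi3 (x : R) :
  cos (x + pi / 3) = cos x / 2 - Num.sqrt 3 / 2 * sin x.
Proof. by rewrite cosD cos_pi3 sin_pi3; ring. Qed.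

Lemma sinDpi3 (x : R) :
  sin (x + pi / 3) = sin x / 2 + Num.sqrt 3 / 2 * cos x.
Proof. by rewrite sinD cos_pi3 sin_pi3; ring. Qed.

(** Up to the factor r, the direction of longitude x in hexagonal
    coordinates. *)
Definition hex_direction (x r : R) (p : int * int) :=
  r * cos x = p.1%:~R / 2 /\ r * sin x = p.2%:~R * Num.sqrt 3 / 6.

(** Turning by pi / 3 preserves the lattice: it acts on the coordinates as
    (a, b) |-> ((a - b) / 2, (b + 3 a) / 2). *)
Lemma hex_directionD x r a b a' b' :
  hex_direction x r (a, b) -> a - b = a' * 2 -> b + 3 * a = b' * 2 ->
  hex_direction (x + pi / 3) r (a', b').
Proof.
have s3 : Num.sqrt 3 ^+ 2 = 3 :> R by rewrite sqr_sqrtr.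
move=> [/= rc rs] /(congr1 (fun z : int => z%:~R : R)) aE.
move=> /(congr1 (fun z : int => z%:~R : R)) bE.
rewrite !(rmorphB, rmorphD, rmorphM, rmorph_nat) in aE bE.
split=> /=.
  rewrite cosDpi3 mulrBr mulrA rc mulrCA rs.
  transitivity (a%:~R / 4 - b%:~R * Num.sqrt 3 ^+ 2 / 12 : R); first by field.
  rewrite s3; move: aE; lra.
rewrite sinDpi3 mulrDr mulrA rs mulrCA rc.
transitivity ((b%:~R + 3 * a%:~R) * Num.sqrt 3 / 12 : R); first by field.
by rewrite bE; field.
Qed.

Lemma sphere_pt_hex (x h : R) a b c :
  hex_direction x (Num.sqrt (1 - h ^+ 2)) (a, b) ->
  h = c%:~R * Num.sqrt (2 / 3) -> sphere_pt x h = hex_pt (a, b, c).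
Proof.
move=> [/= xc xs] hE; apply/rowP => k; rewrite !mxE xc xs.
by case: k => [[|[|[|//]]]].
Qed.

(** Only the first vertex of a hexagon needs a trigonometric evaluation; the
    others follow by successive turns. *)
Lemma hex_direction_path x r p s :
  hex_direction x r p ->
  path (fun p q => (p.1 - p.2 == q.1 * 2) && (p.2 + 3 * p.1 == q.2 * 2)) p s ->
  forall k, (k <= size s)%N ->
    hex_direction (x + k%:R * (pi / 3)) r (nth 0 (p :: s) k).
Proof.
elim: s p x => [|[a' b'] s IHs] [a b] x xp.
  by move=> _ [|//] _; rewrite mul0r addr0.
move=> /= /andP[/andP[/eqP aE /eqP bE] ps] [|k] ks.
  by rewrite mul0r addr0.
have xp' := hex_directionD x r a b a' b' xp aE bE.
have := IHs (a', b') (x + pi / 3) xp' ps k ks.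
by rewrite -addrA -[X in X + _ * _]mul1r -mulrDl nat1r.
Qed.

Lemma equator_pt k : (k < 6)%N ->
  sphere_pt (k%:R * pi / 3) 0 = hex_pt (nth 0 hex_equator k).
Proof.
move=> k6; have d0 : hex_direction 0 (Num.sqrt (1 - 0 ^+ 2)) (2, 0).
  by rewrite /hex_direction/= cos0 sin0 expr0n subr0 sqrtr1; split; field.
have /= := hex_direction_path 0 _ (2, 0)
  [:: (1, 3); (-1, 3); (-2, 0); (-1, -3); (1, -3)] d0 isT k k6.
rewrite add0r mulrA.
case: k k6 => [|[|[|[|[|[|//]]]]]] _ d; apply: sphere_pt_hex d _;
  by rewrite mul0r.
Qed.

(** The two possible caps consist of alternate vertices of one hexagon. *)
Lemma cap_direction k : (k < 6)%N ->
  hex_direction (pi / 6 + k%:R * (pi / 3)) (Num.sqrt 3 / 3)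
    (nth 0 [:: (1, 1); (0, 2); (-1, 1); (-1, -1); (0, -2); (1, -1)] k).
Proof.
move=> k6; apply: (hex_direction_path _ _ (1, 1)
  [:: (0, 2); (-1, 1); (-1, -1); (0, -2); (1, -1)]) => //.
rewrite /hex_direction/= cos_pi6 sin_pi6.
have s3 : Num.sqrt 3 * Num.sqrt 3 = 3 :> R by rewrite -expr2 sqr_sqrtr.
by split; [rewrite mulrACA s3|]; field.
Qed.

Lemma sqr_sphere_height (z : int) : z ^+ 2 = 1 ->
  Num.sqrt (1 - (z%:~R * Num.sqrt (2 / 3)) ^+ 2) = Num.sqrt 3 / 3 :> R.
Proof.
by move=> z1; rewrite exprMn -rmorphXn/= z1 mul1r sqrt_sphere_height.
Qed.

Lemma cap_pt (z : int) h k : z ^+ 2 = 1 -> h = z%:~R * Num.sqrt (2 / 3) ->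
  (k < 3)%N ->
  sphere_pt (pi / 6 + 2 * pi * k%:R / 3) h = hex_pt (nth 0 (hex_cap z) k).
Proof.
move=> z1 hE k3; have k6 : (k.*2 < 6)%N by rewrite -(ltn_double k 3) in k3.
have := cap_direction k.*2 k6; rewrite -(sqr_sphere_height z z1) -hE.
rewrite -mul2n natrM (_ : _ + _ = pi / 6 + 2 * pi * k%:R / 3); last by field.
by case: k k3 {k6} => [|[|[|//]]] _ d; apply: sphere_pt_hex d hE.
Qed.

Lemma cap_turned_pt (z : int) h k :
  z ^+ 2 = 1 -> h = z%:~R * Num.sqrt (2 / 3) -> (k < 3)%N ->
  sphere_pt (pi / 2 + 2 * pi * k%:R / 3) h =
  hex_pt (nth 0 (hex_cap_turned z) k).
Proof.
move=> z1 hE k3; have k6 : (k.*2.+1 < 6)%N by move: k k3 => [|[|[|]]].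
have := cap_direction k.*2.+1 k6; rewrite -(sqr_sphere_height z z1) -hE.
rewrite -[k.*2.+1%:R]natr1 -mul2n natrM.
rewrite (_ : _ + _ = pi / 2 + 2 * pi * k%:R / 3); last by field.
by case: k k3 {k6} => [|[|[|//]]] _ d; apply: sphere_pt_hex d hE.
Qed.

Lemma FCC0E (i : 'I_12) : FCC0 R i = hex_pt (nth 0 fcc_coord i).
Proof.
rewrite /FCC0 /fcc_coord nth_cat; case: ltnP => i6; first exact: equator_pt.
rewrite nth_cat -[size _]/6%N ltn_subLR// -[size _]/3%N; case: ltnP => i9.
  by apply: cap_pt; rewrite ?mul1r// ltn_subLR.
rewrite -subnDA; apply: cap_turned_pt; rewrite ?mulN1r//.
by rewrite ltn_subLR// ltn_ord.
Qed.

Lemma HCP0E (i : 'I_12) : HCP0 R i = hex_pt (nth 0 hcp_coord i).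
Proof.
rewrite /HCP0 /hcp_coord nth_cat; case: ltnP => i6; first exact: equator_pt.
rewrite nth_cat -[size _]/6%N ltn_subLR// -[size _]/3%N; case: ltnP => i9.
  by apply: cap_pt; rewrite ?mul1r// ltn_subLR.
rewrite -subnDA; apply: cap_pt; rewrite ?mulN1r//.
by rewrite ltn_subLR// ltn_ord.
Qed.

End HexPt.

(** * From integral equations to balanced stresses *)

Lemma acos_half (R : realType) : acos (1 / 2) = pi / 3 :> R.
Proof.
rewrite -cos_pi3 cosK// in_itv/=; have := pi_gt0 R => p0.
by apply/andP; split; lra.
Qed.

Lemma min_angle_pi3 (R : realType) n (U : config R n) :
  (forall i, sphere (U i)) ->
  (forall i j, i != j -> dot (U i) (U j) <= 1 / 2) ->
  (exists i j, dot (U i) (U j) = 1 / 2) -> min_angle U = pi / 3.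
Proof.
move=> sU le_half [i [j ij]]; have p0 := pi_gt0 R.
have ij' : i != j.
  apply: contra_eq_neq ij => ->; have /sphere_dot -> := sU j.
  by apply/eqP; lra.
apply/le_anti/andP; split.
  by rewrite -acos_half -ij min_angle_le.
apply: le_bigmin => [|[k l] /= kl]; first lra.
rewrite leNgt; apply/negP => kl3; have := le_half k l kl.
rewrite -cos_pi3 -(cos_angle (U k))// leNgt ltr_cos ?kl3//;
  rewrite in_itv/= ?angle_itv//.
by apply/andP; split; lra.
Qed.

Lemma sphere_radius_pi3 (R : realType) n (U : config R n) :
  min_angle U = pi / 3 -> sphere_radius U = 1.
Proof.
move=> m3; rewrite /sphere_radius /inj_radius m3.
by rewrite (_ : pi / 3 / 2 = pi / 6) ?sin_pi6; field.
Qed.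

(** Turns weights on pairs of labels into weights on sets of labels; on an edge
    both orders are counted, which doubles a symmetric weight. *)
Definition pair_weight (R : realType) n (W : 'I_n -> 'I_n -> nat)
    (e : {set 'I_n}) : R :=
  (\sum_(i in e) \sum_(j in e :\ i) W i j)%N%:R.

Lemma pair_weightE (R : realType) n (W : 'I_n -> 'I_n -> nat) i j :
  (forall i j, W i j = W j i) -> i != j ->
  pair_weight R n W [set i; j]%SET = (W i j).*2%:R.
Proof.
move=> WC ij; rewrite /pair_weight big_setU1 ?finset.in_set1//= big_set1.
rewrite setU1K ?finset.in_set1// finset.setUC setU1K ?finset.in_set1 1?eq_sym//.
by rewrite !big_set1 (WC j) addnn.
Qed.

Lemma hex_ptMn (R : realType) (x y : tricoord) k :
  hex_pt ((x - y *+ 2) *+ k) = k%:R *: (hex_pt x - 2 *: hex_pt y) :> 'rV[R]_3.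
Proof. by rewrite raddfMn/= raddfB/= raddfMn/= !scaler_nat. Qed.

(** On a contact edge the outward tangent vector is a constant times
    u - 2 v, so the fourth hypothesis is exactly the equilibrium at each
    vertex. *)
Lemma hex_config (R : realType) n (x : 'I_n -> tricoord)
    (W : 'I_n -> 'I_n -> nat) (Q : 'M[R]_3) (U : config R n) :
  (forall i, hex_dot (x i) (x i) = 12) ->
  (forall i j, i != j -> hex_dot (x i) (x j) <= 6) ->
  (forall i j, W i j = W j i) ->
  (forall i,
    \sum_(j | hex_dot (x i) (x j) == 6) (x i - x j *+ 2) *+ W i j = 0) ->
  (exists i j, hex_dot (x i) (x j) = 6 /\ W i j != 0%N) ->
  SO3 Q -> (forall i, U i = hex_pt (x i) *m Q) ->
  [/\ Conf U, min_angle U = pi / 3, sphere_radius U = 1 & is_balanced U].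
Proof.
move=> x12 x6 WC Wbal [i0 [j0 [c0 W0]]] [QQ _] UE.
have dotU i j : dot (U i) (U j) = (hex_dot (x i) (x j))%:~R / 12.
  by rewrite !UE dot_mulmx// dot_hex_pt.
have halfE : 6%:~R / 12 = 1 / 2 :> R by rewrite rmorph_nat; field.
have sU i : sphere (U i).
  by apply/sphere_dot; rewrite dotU x12 rmorph_nat divff.
have dot_half i j : (dot (U i) (U j) == 1 / 2) = (hex_dot (x i) (x j) == 6).
  by rewrite dotU -halfE (can_eq (divfK _))// eqr_int.
have dot_le i j : i != j -> dot (U i) (U j) <= 1 / 2.
  by move=> ij; rewrite dotU -halfE ler_pM2r ?invr_gt0// ler_int x6.
have m3 : min_angle U = pi / 3.
  by apply: min_angle_pi3 => //; exists i0, j0; apply/eqP; rewrite dot_half c0.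
have contactE i j : contact U i j = (hex_dot (x i) (x j) == 6).
  apply/idP/eqP => [cij|cij].
    by apply/eqP; rewrite -dot_half (contact_dot U)// m3 cos_pi3.
  rewrite /contact double_inj_radius m3 /angle dotU cij halfE acos_half eqxx.
  rewrite andbT.
  by apply: contra_eq_neq cij => ->; rewrite x12.
split=> //; [|exact: sphere_radius_pi3|].
  split=> // i j Uij; apply/eqP; apply: contraTT isT => ij.
  have := dot_le i j ij; rewrite Uij; have /sphere_dot -> := sU j.
  by rewrite leNgt; lra.
exists (pair_weight R n W); split.
- by move=> e _; rewrite /pair_weight ler0n.
- move=> i; pose c : R := (Num.sqrt (1 - (1 / 2) ^+ 2))^-1.
  transitivity (c *: (hex_pt (\sum_(j | hex_dot (x i) (x j) == 6)
      (x i - x j *+ 2) *+ W i j) *m Q)); last first.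
    by rewrite Wbal raddf0 mul0mx scaler0.
  rewrite raddf_sum/= mulmx_suml scaler_sumr.
  apply: eq_big => [j|j cij]; first exact: contactE.
  have /andP[ij _] := cij; rewrite pair_weightE// /outward_tangent.
  rewrite enorm_outward_tangent// (contact_dot U)// m3 cos_pi3 -/c.
  rewrite hex_ptMn -scalemxAl mulmxBl -scalemxAl -!UE -muln2 natrM.
  have -> : (1 / 2) *: U i - U j = (1 / 2) *: (U i - 2 *: U j).
    by rewrite scalerBr scalerA mul1r mulVf ?scale1r.
  by rewrite !scalerA; congr (_ *: _); field.
exists [set i0; j0]%SET; first by exists i0, j0; rewrite contactE c0.
rewrite pair_weightE//; first by rewrite pnatr_eq0 double_eq0.
by apply: contra_eq_neq c0 => ->; rewrite x12.
Qed.

(** * The FCC and HCP configurations *)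

Definition hex_certificate (T : seq tricoord) (W : nat -> nat -> nat) : bool :=
  let I := iota 0 (size T) in let x := nth 0 T in
  [&& all (fun i => hex_dot (x i) (x i) == 12) I,
    all (fun i => all (fun j => (i != j) ==> (hex_dot (x i) (x j) <= 6)) I) I,
    all (fun i => all (fun j => W i j == W j i) I) I,
    all (fun i => \sum_(0 <= j < size T | hex_dot (x i) (x j) == 6)
      (x i - x j *+ 2) *+ W i j == 0) I
  & has (fun i => has (fun j =>
      (hex_dot (x i) (x j) == 6) && (W i j != 0%N)) I) I].

Lemma hex_certificateP (R : realType) n T W (x0 U : config R n) :
  size T = n -> hex_certificate T W -> (forall i, x0 i = hex_pt (nth 0 T i)) ->
  same_up_to_rotation_and_labels x0 U ->
  [/\ Conf U, min_angle U = pi / 3, sphere_radius U = 1 & is_balanced U].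
Proof.
move=> sT /and5P[]; rewrite sT => T12 T6 TW Tbal Thas x0E [Q SQ [s UE]].
have I (i : 'I_n) : (i : nat) \in iota 0 n by rewrite mem_iota/=.
apply: (hex_config R n (fun i => nth 0 T (s i))
  (fun i j => W (s i) (s j)) Q) => //.
- by move=> i; apply/eqP/(allP T12).
- move=> i j ij; have /allP/(_ _ (I (s j)))/implyP := allP T6 _ (I (s i)).
  by apply; rewrite (inj_eq val_inj) (inj_eq perm_inj).
- by move=> i j; apply/eqP; have /allP := allP TW _ (I (s i)); apply.
- move=> i; have /eqP := allP Tbal _ (I (s i)).
  by rewrite big_mkord (reindex_inj (@perm_inj _ s)).
- have /hasP[i + /hasP[j + /andP[/eqP ij Wij]]] := Thas.
  rewrite !mem_iota/= add0n => ni nj.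
  by exists ((s^-1)%g (Ordinal ni)), ((s^-1)%g (Ordinal nj)); rewrite !permKV.
- by move=> i; rewrite UE x0E.
Qed.

(** The pairs {0, 1}, {2, 3}, {4, 5} of equatorial points share an upper and a
    lower neighbour.  If the caps pull with weight 3, equilibrium at an
    equatorial point asks that the two equatorial weights differ by 2. *)
Definition hcp_weight (i j : nat) : nat :=
  if [&& (i < 6)%N, (j < 6)%N & i./2 == j./2] then 1 else 3.

Lemma fcc_certificate : hex_certificate fcc_coord (fun _ _ => 1%N).
Proof. by rewrite /hex_certificate unlock; vm_compute. Qed.

Lemma hcp_certificate : hex_certificate hcp_coord hcp_weight.
Proof. by rewrite /hex_certificate unlock; vm_compute. Qed.

Theorem theorem5p3 (R : realType) :
  [/\ forall U : config R 12, is_FCC U ->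
        [/\ Conf U, min_angle U = pi / 3, sphere_radius U = 1 & is_balanced U],
      forall U : config R 12, is_HCP U ->
        [/\ Conf U, min_angle U = pi / 3, sphere_radius U = 1 & is_balanced U]
    & critical_value 12 (1 : R)].
Proof.
have fcc (U : config R 12) (hU : is_FCC U) :=
  hex_certificateP R 12 fcc_coord _ _ U erefl fcc_certificate FCC0E hU.
split=> // [U hU|].
  exact: (hex_certificateP R 12 hcp_coord _ _ U erefl hcp_certificate HCP0E hU).
have rot Q : SO3 Q -> is_FCC (rotate Q (FCC0 R)).
  by move=> SQ; exists Q => //; exists 1%g => i; rewrite perm1.
have S1 : @SO3 R 1%:M by split; rewrite ?trmx1 ?mulmx1 ?det1.
have rot1 : rotate 1%:M (FCC0 R) = FCC0 R.
  by apply/funext => i; rewrite /rotate mulmx1.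
exists (orbit_SO3 (FCC0 R)).
  by exists (FCC0 R) => //; have [] := fcc _ (rot _ S1); rewrite rot1.
move=> _ [Q SQ <-]; have [CU m3 r1 bU] := fcc _ (rot _ SQ); split=> //.
apply: balanced_critical => //; rewrite m3; have p0 := pi_gt0 R.
by apply/andP; split; lra.
Qed.
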